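(* Let $\mathcal{H}$ be a complex Hilbert space, let $T \in B(\mathcal{H})$, and let $N(\cdot)$ be an algebra norm on $B(\mathcal{H})$. Then $$dw_N(T) \geq \frac12 \sqrt{N(|T|^2 + |T^*|^2) + 2N^4(|T|) + 2\left| N^2(\Re(T)) + N^4(|T|) - N^2(\Im(T)) \right|}$$ and $$dw_N(T) \geq \frac12 \sqrt{N(T^2 + T^{*2}) + 2N^4(|T|) + 2\left| N^2(\Re(T)) + N^4(|T|) - N^2(\Im(T)) \right|}.$$
   Context: $B(\mathcal{H})$ is the $C^*$-algebra of bounded linear operators on the complex Hilbert space $\mathcal{H}$. For $T \in B(\mathcal{H})$, $T^*$ is the adjoint, $T^{*2} = (T^* )^2$, $|T| = (T^*T)^{1/2}$, $|T^*| = (TT^* )^{1/2}$, $\Re(T) = \frac12(T + T^* )$ and $\Im(T) = \frac{1}{2i}(T - T^* )$. A norm $N(\cdot)$ on $B(\mathcal{H})$ (as a complex vector space) is an algebra norm if $N(TS) \leq N(T)N(S)$ for all $T, S \in B(\mathcal{H})$. $N^k(X)$ means $(N(X))^k$. The generalized Davis--Wielandt radius is $dw_N(T) = \sup_{\theta \in \mathbb{R}} \sqrt{N^2(\Re(e^{i\theta}T)) + N^4(\Re(e^{i\theta}|T|))}$. *)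

(* Defs.v *)
From HB Require Import structures.
From mathcomp Require Import all_boot all_order all_algebra.
From mathcomp Require Import complex.
From mathcomp Require Import boolp classical_sets functions reals topology.
From mathcomp Require Import normedtype trigo.

Set Implicit Arguments.
Unset Strict Implicit.
Unset Printing Implicit Defensive.

Import Order.TTheory GRing.Theory Num.Theory.
Import numFieldNormedType.Exports.

Local Open Scope classical_set_scope.
Local Open Scope ring_scope.
Local Open Scope complex_scope.

(* The inner product is linear in its first argument and conjugate-linear in
   the second one. *)
HB.mixin Record CompleteNormedModule_isHilbert (R : realType) H
    & CompleteNormedModule R[i] H := {
  inner : {dot H for Num.conj} ;
  inner_norm : forall x : H, inner x x = `|x| ^+ 2
}.

#[short(type="hilbertType")]
HB.structure Definition Hilbert (R : realType) :=
  {H of CompleteNormedModule R[i] H & CompleteNormedModule_isHilbert R H}.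

Section BoundedOperators.
Context {R : realType} (H : hilbertType R).

Definition is_bounded_op : {pred H -> H} := [pred f : H -> H |
  `[< linear f /\ exists M : R, forall x, `|f x| <= M%:C * `|x| >]].

Record bounded_op := BoundedOp {
  op_fun :> H -> H ;
  op_funP : op_fun \in is_bounded_op }.

HB.instance Definition _ := [isSub for op_fun].
HB.instance Definition _ := [Choice of bounded_op by <:].

Lemma is_bounded_opP (f : H -> H) :
  reflect (linear f /\ exists M : R, forall x, `|f x| <= M%:C * `|x|)
          (f \in is_bounded_op).
Proof. by rewrite inE; exact: asboolP. Qed.

Lemma is_bounded_op_ge0 (f : H -> H) : f \in is_bounded_op ->
  exists2 M : R, 0 <= M & forall x, `|f x| <= M%:C * `|x|.
Proof.
move=> /is_bounded_opP[_ [M fM]]; exists `|M| => // x.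
by rewrite (le_trans (fM x))// ler_wpM2r// lecR ler_norm.
Qed.

Fact is_bounded_op_submod : submod_closed is_bounded_op.
Proof.
split=> [|a f g /[dup] fB /is_bounded_opP[fL _] /[dup] gB /is_bounded_opP[gL _]].
  apply/is_bounded_opP; split.
    by move=> a x y; rewrite /GRing.zero /= scaler0 addr0.
  by exists 0 => x; rewrite normr0 mul0r.
have [Mf Mf0 fM] := is_bounded_op_ge0 fB.
have [Mg Mg0 gM] := is_bounded_op_ge0 gB.
apply/is_bounded_opP; split=> [b x y|].
  rewrite !fctE fL gL !scalerDr !scalerA (mulrC a) -!addrA; congr (_ + _).
  by rewrite addrCA.
exists (complex.Re `|a| * Mf + Mg) => x; rewrite !fctE (le_trans (ler_normD _ _))//.
rewrite raddfD/= mulrDl lerD// normrZ rmorphM/=.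
by rewrite -mulrA ler_wpM2l.
Qed.

HB.instance Definition _ := GRing.isSubmodClosed.Build R[i] (H -> H)
  is_bounded_op is_bounded_op_submod.
HB.instance Definition _ := [SubChoice_isSubLmodule of bounded_op by <:].

Fact id_is_bounded_op : id \in is_bounded_op.
Proof. by apply/is_bounded_opP; split=> //; exists 1 => x; rewrite mul1r. Qed.

Fact comp_is_bounded_op (S T : bounded_op) : S \o T \in is_bounded_op.
Proof.
have /is_bounded_opP[SL _] := op_funP S; have /is_bounded_opP[TL _] := op_funP T.
have [M M0 SM] := is_bounded_op_ge0 (op_funP S).
have [M' M'0 TM] := is_bounded_op_ge0 (op_funP T).
apply/is_bounded_opP; split=> [a x y /=|]; first by rewrite TL SL.
exists (M * M') => x /=; rewrite (le_trans (SM _))// rmorphM/= -mulrA.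
by rewrite ler_wpM2l// lecR.
Qed.

Definition op_one : bounded_op := BoundedOp id_is_bounded_op.
Definition op_mul (S T : bounded_op) : bounded_op :=
  BoundedOp (comp_is_bounded_op S T).

Fact op_mulA : associative op_mul. Proof. by move=> S T U; exact/val_inj. Qed.
Fact op_mul1l : left_id op_one op_mul. Proof. by move=> S; exact/val_inj. Qed.
Fact op_mul1r : right_id op_one op_mul. Proof. by move=> S; exact/val_inj. Qed.
Fact op_mulDl : left_distributive op_mul +%R.
Proof. by move=> S T U; exact/val_inj. Qed.
Fact op_mulDr : right_distributive op_mul +%R.
Proof.
move=> S T U; apply/val_inj/funext => x /=.
have /is_bounded_opP[SL _] := op_funP S.
by have := SL 1 (T x) (U x); rewrite !scale1r.
Qed.

(* Only a pzRingType, since H, hence B(H), may be trivial. The product of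
   S and T is S \o T. *)
HB.instance Definition _ := GRing.Zmodule_isPzRing.Build bounded_op
  op_mulA op_mul1l op_mul1r op_mulDl op_mulDr.

End BoundedOperators.

Section Operators.
Context {R : realType} {H : hilbertType R}.
Implicit Types S T A : bounded_op H.

(* The adjoint exists (Riesz) and is unique, so the default 0 is never used. *)
Definition adjoint T : bounded_op H :=
  xget (0 : bounded_op H) [set S | forall x y, inner (T x) y = inner x (S y)].

(* The order is that of R[i]: a nonnegative element is in particular real. *)
Definition positive_op A : Prop := forall x, 0 <= inner (A x) x.

(* The positive square root, unique for A positive; the default 0 is used only
   if A is not positive. *)
Definition sqrt_op A : bounded_op H :=
  xget (0 : bounded_op H) [set S | positive_op S /\ S ^+ 2 = A].

Definition abs_op T : bounded_op H := sqrt_op (adjoint T * T).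

Definition re_op T : bounded_op H := 2^-1 *: (T + adjoint T).

Definition im_op T : bounded_op H := (2 * 'i)^-1 *: (T - adjoint T).

Record algebra_norm (N : bounded_op H -> R) : Prop := AlgebraNorm {
  anorm_ge0 : forall T, 0 <= N T ;
  anorm_eq0 : forall T, N T = 0 -> T = 0 ;
  anormZ : forall (a : R[i]) T, (N (a *: T))%:C = `|a| * (N T)%:C ;
  anormD : forall S T, N (S + T) <= N S + N T ;
  anormM : forall S T, N (S * T) <= N S * N T }.

Definition expi (theta : R) : R[i] := cos theta +i* sin theta.

Definition dw (N : bounded_op H -> R) T : R :=
  sup [set Num.sqrt (N (re_op (expi theta *: T)) ^+ 2
                     + N (re_op (expi theta *: abs_op T)) ^+ 4)
      | theta in [set: R]].

End Operators.

(* Main.v *)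
Require Import Defs.
From mathcomp Require Import all_boot all_order all_algebra.
From mathcomp Require Import complex ring lra.
From mathcomp Require Import boolp classical_sets functions reals topology.
From mathcomp Require Import normedtype sequences trigo.
Import Order.TTheory GRing.Theory Num.Theory.
Import numFieldNormedType.Exports.
Local Open Scope classical_set_scope.
Local Open Scope ring_scope.
Local Open Scope complex_scope.
Set Implicit Arguments.
Unset Strict Implicit.
Unset Printing Implicit Defensive.

(** The supremum defining dw N T dominates its values at the angles 0 and
    - pi / 2. As |T| is self-adjoint, these are the square roots of
    p = N (Re T)^2 + N |T|^4 and of q = N (Im T)^2 ([dw_ge_re], [dw_ge_im]).
    Hence dw^2 >= max p q = (p + q + |p - q|) / 2. Since N is submultiplicative,
    N (Re T)^2 + N (Im T)^2 dominates both N ((Re T)^2 + (Im T)^2) and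
    N ((Re T)^2 - (Im T)^2). These operators are (|T|^2 + |T^*|^2) / 2 and
    (T^2 + T^*^2) / 2, so the two inequalities follow from the single estimate
    [dw_lower_bound].

    The argument uses that T^* really is an adjoint and that |T| is a positive
    square root of T^* T, so both must be shown to exist.

    Adjoints come from the Riesz representation theorem ([real_riesz]), proved
    for the real inner product Re (inner x y) by minimising
    |z|^2 - 2 f z with the parallelogram law.

    For the square root, rescale T to a contraction and put B = 1 - T^* T, a
    self-adjoint contraction. A square root 1 - Y of 1 - B is a solution of
    Y = (B + Y^2) / 2. The iterates Y_n from 0 commute with each other, so that
    |Y_(n+1) - Y_n| <= y_(n+1) - y_n for the scalar iterates
    y_(n+1) = (1 + y_n^2) / 2, which increase and stay below 1
    ([sqrt_iter_step_le]). Therefore Y_n converges pointwise, and its limit is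
    the required Y ([sqrt_one_sub]). *)

(** * The real inner product space underlying a complex Hilbert space *)

Section RealStructure.
Context {R : realType} {H : hilbertType R}.
Implicit Types (x y z : H) (t : R).

(** The norm of H takes its values in R[i]; estimates are easier for its real
    part, which carries the same information by [hnormE]. *)
Definition hnorm x : R := complex.Re `|x|.

(** The real part of the inner product is a real inner product with the same
    norm, and determines the complex one by [innerE]. *)
Definition rdot x y : R := complex.Re (inner x y).

Lemma hnormE x : `|x| = (hnorm x)%:C.
Proof. by rewrite /hnorm RRe_real// normr_real. Qed.

Lemma hnorm_ge0 x : 0 <= hnorm x.
Proof. by have := normr_ge0 x; rewrite hnormE lecR. Qed.

Lemma hnorm_eq0 x : hnorm x = 0 -> x = 0.
Proof. by move=> x0; apply/normr0_eq0; rewrite hnormE x0. Qed.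

Lemma hnorm0 : hnorm 0 = 0.
Proof. by rewrite /hnorm normr0. Qed.

Lemma hnormN x : hnorm (- x) = hnorm x.
Proof. by rewrite /hnorm normrN. Qed.

Lemma hnormB x y : hnorm (x - y) = hnorm (y - x).
Proof. by rewrite -hnormN opprB. Qed.

Lemma ler_hnormD x y : hnorm (x + y) <= hnorm x + hnorm y.
Proof. by have := ler_normD x y; rewrite !hnormE -rmorphD/= lecR. Qed.

Lemma hnormZ (a : R[i]) x : hnorm (a *: x) = complex.Re `|a| * hnorm x.
Proof.
by rewrite /hnorm normrZ hnormE normc_def -rmorphM.
Qed.

Lemma rdotDl x y z : rdot (x + y) z = rdot x z + rdot y z.
Proof. by rewrite /rdot linearDl raddfD. Qed.

Lemma rdotNl x y : rdot (- x) y = - rdot x y.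
Proof. by rewrite /rdot linearNl raddfN. Qed.

Lemma rdotZl t x y : rdot (t%:C *: x) y = t * rdot x y.
Proof.
by rewrite /rdot linearZl_LR/=; case: (inner x y) => a b /=; ring.
Qed.

Lemma innerC x y : inner x y = Num.conj (inner y x).
Proof. by rewrite (hermC inner) expr0 mul1r. Qed.

Lemma rdotC x y : rdot x y = rdot y x.
Proof. by rewrite /rdot innerC; case: (inner y x). Qed.

Lemma rdotDr x y z : rdot x (y + z) = rdot x y + rdot x z.
Proof. by rewrite rdotC rdotDl !(rdotC x). Qed.

Lemma rdotNr x y : rdot x (- y) = - rdot x y.
Proof. by rewrite rdotC rdotNl rdotC. Qed.

Lemma rdotZr t x y : rdot x (t%:C *: y) = t * rdot x y.
Proof. by rewrite rdotC rdotZl rdotC. Qed.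

Lemma rdot0l x : rdot 0 x = 0.
Proof. by rewrite /rdot linear0l. Qed.

Lemma rdotxx x : rdot x x = hnorm x ^+ 2.
Proof. by rewrite /rdot inner_norm hnormE -rmorphXn. Qed.

Lemma hnormD_sqr x y :
  hnorm (x + y) ^+ 2 = hnorm x ^+ 2 + hnorm y ^+ 2 + 2 * rdot x y.
Proof. by rewrite -!rdotxx !rdotDl !rdotDr (rdotC y x); ring. Qed.

Lemma hnormB_sqr x y :
  hnorm (x - y) ^+ 2 = hnorm x ^+ 2 + hnorm y ^+ 2 - 2 * rdot x y.
Proof. by rewrite hnormD_sqr hnormN rdotNr; ring. Qed.

Lemma innerE x y : inner x y = rdot x y +i* - rdot ('i *: x) y.
Proof.
rewrite /rdot linearZl_LR/=; case: (inner x y) => a b /=.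
by congr (_ +i* _); ring.
Qed.

(** Cauchy-Schwarz: expand the square of the norm of |y| x - |x| y. *)
Lemma rdot_le x y : rdot x y <= hnorm x * hnorm y.
Proof.
have [x0|x0] := eqVneq (hnorm x) 0.
  by rewrite x0 (hnorm_eq0 x0) rdot0l mul0r.
have [y0|y0] := eqVneq (hnorm y) 0.
  by rewrite y0 (hnorm_eq0 y0) rdotC rdot0l mulr0.
have xy : 0 < hnorm x * hnorm y.
  by rewrite mulr_gt0// lt0r ?x0 ?y0 hnorm_ge0.
have := sqr_ge0 (hnorm ((hnorm y)%:C *: x - (hnorm x)%:C *: y)).
rewrite -rdotxx !(rdotDl, rdotDr, rdotNl, rdotNr, rdotZl, rdotZr) !rdotxx.
rewrite (rdotC y) -[in X in _ -> X](ler_pM2l xy) => ?; nra.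
Qed.

Lemma rdot_abs_le x y : `|rdot x y| <= hnorm x * hnorm y.
Proof.
by rewrite ler_norml rdot_le andbT lerNl -rdotNl -(hnormN x) rdot_le.
Qed.

Lemma rdot_inj x y : (forall z, rdot z x = rdot z y) -> x = y.
Proof.
move=> xy; apply/eqP; rewrite -subr_eq0; apply/eqP/hnorm_eq0/eqP.
by rewrite -sqrf_eq0 -rdotxx rdotDr rdotNr xy subrr.
Qed.

(** The next lemmas translate convergence in H, whose entourages are indexed by
    positive elements of R[i], to convergence of real sequences. *)
Lemma cvg_hnorm_dominated (u : nat -> H) (l : H) (a : nat -> R) :
  (forall n, hnorm (u n - l) <= a n) -> a @ \oo --> (0 : R) -> u @ \oo --> l.
Proof.
move=> ua a0; apply/cvgrPdist_lt => e e0.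
have eE : e = (complex.Re e)%:C by rewrite RRe_real// gtr0_real.
have re0 : 0 < complex.Re e by rewrite -ltcR -eE.
move/cvgrPdist_lt : a0 => /(_ _ re0); apply: filterS => n /=.
rewrite sub0r normrN => an.
rewrite eE hnormE ltcR hnormB (le_lt_trans (ua n))//.
exact: le_lt_trans (ler_norm _) an.
Qed.

Lemma cvg_hnorm (u : nat -> H) (l : H) :
  u @ \oo --> l -> (fun n => hnorm (u n - l)) @ \oo --> (0 : R).
Proof.
move=> ul; apply/cvgrPdist_lt => e e0.
have e0C : 0 < e%:C by rewrite ltcR.
move/cvgrPdist_lt : ul => /(_ _ e0C); apply: filterS => n /=.
by rewrite hnormE ltcR sub0r normrN ger0_norm ?hnorm_ge0// hnormB.
Qed.

Lemma cvg_hnorm_le (u : nat -> H) (l : H) (c : R) :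
  u @ \oo --> l -> (forall n, hnorm (u n) <= c) -> hnorm l <= c.
Proof.
move=> /cvg_hnorm ul uc.
have cD : (fun n => c + hnorm (u n - l)) @ \oo --> c.
  by rewrite -[X in _ --> X]addr0; apply: cvgD ul; exact: cvg_cst.
apply: ler_cvg_to (cvg_cst _) cD _; apply: nearW => n.
rewrite hnormB -[X in hnorm X <= _](subrK (u n)) addrC.
by rewrite (le_trans (ler_hnormD _ _))// lerD2r.
Qed.

(** A Cauchy criterion of a shape met both by minimising sequences and by
    sequences controlled by a convergent real majorant. *)
Lemma hnorm_complete (u : nat -> H) (a : nat -> R) : a @ \oo --> (0 : R) ->
  (forall m n, hnorm (u m - u n) <= a m + a n) -> cvgn u.
Proof.
move=> a0 ua; apply: cauchy_cvg; apply: cauchy_exP => e e0.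
have eE : e = (complex.Re e)%:C by rewrite RRe_real// gtr0_real.
have re0 : 0 < complex.Re e / 2 by rewrite divr_gt0// -ltcR -eE.
move/cvgrPdist_lt : a0 => /(_ _ re0)[n _ an].
exists (u n), n => //= m nm; rewrite -ball_normE/= eE hnormE ltcR.
have := an n (leqnn n); have := an m nm; rewrite /= !sub0r !normrN => am an'.
have := ua n m.
by have := ler_norm (a n); have := ler_norm (a m); lra.
Qed.

Lemma cvg_rdot (u : nat -> H) (l x : H) :
  u @ \oo --> l -> (fun n => rdot (u n) x) @ \oo --> rdot l x.
Proof.
move=> /cvg_hnorm ul; apply/subr_cvg0.
apply/norm_cvg0P.
have : (fun n => hnorm (u n - l) * hnorm x) @ \oo --> (0 : R).
  by rewrite -(mul0r (hnorm x)); apply: cvgM ul _; exact: cvg_cst.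
apply: squeeze_cvgr; last exact: cvg_cst.
by apply: nearW => n; rewrite normr_ge0 -rdotNl -rdotDl rdot_abs_le.
Qed.

End RealStructure.

(** * Riesz representation and adjoints *)

Section RieszAdjoint.
Context {R : realType} {H : hilbertType R}.
Implicit Types (x y z : H) (t : R).

(** The parabola a t^2 + 2 r t takes negative values near 0 unless r = 0; the
    value t = - r / (a + 1) also covers a = 0. *)
Lemma quadratic_ge0_eq0 (a r : R) :
  0 <= a -> (forall t, 0 <= t ^+ 2 * a + 2 * t * r) -> r = 0.
Proof.
move=> a0 /(_ (- r / (a + 1))) q; apply/eqP; rewrite -sqrf_eq0.
have a1 : 0 < a + 1 by lra.
have : 0 <= - (r ^+ 2 * (a + 2)) / (a + 1) ^+ 2.
  apply: le_trans q _; rewrite le_eqVlt; apply/orP; left; apply/eqP.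
  by field; lra.
rewrite pmulr_lge0 ?invr_gt0 ?exprn_gt0// => ra.
have := sqr_ge0 r => r2; apply/eqP; nra.
Qed.

(** Minimise J z = |z|^2 - 2 f z. By the parallelogram law a minimising sequence
    is Cauchy, and the first variation of J at its limit l says that
    f x = rdot x l. *)
Theorem real_riesz (f : H -> R) (M : R) :
    (forall x y, f (x + y) = f x + f y) ->
    (forall t x, f (t%:C *: x) = t * f x) ->
    (forall x, f x <= M * hnorm x) ->
  exists y, forall x, f x = rdot x y.
Proof.
move=> fD fZ fM.
pose J z := hnorm z ^+ 2 - 2 * f z.
have J_inf : has_inf (range J).
  split; first by exists (J 0); exists 0.
  exists (- M ^+ 2) => _ [z _ <-]; rewrite /J.
  by have := fM z; have := sqr_ge0 (hnorm z - M); nra.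
set m := inf (range J).
have mJ z : m <= J z by apply: ge_inf; [case: J_inf|exists z].
(* J (z n) exceeds the infimum by less than the square of d n, so that the
   parallelogram law bounds |z i - z j| by 2 d i + 2 d j. *)
pose d (n : nat) : R := harmonic n.
have d0 n : 0 < d n by rewrite /d /= invr_gt0.
have /choice[z zJ] n : exists z, J z < m + d n ^+ 2.
  have [_ [w _ <-] wJ] := inf_adherent (exprn_gt0 2 (d0 n)) J_inf.
  by exists w.
have parallelogram x y :
    hnorm (x - y) ^+ 2 = 2 * J x + 2 * J y - 4 * J ((2^-1)%:C *: (x + y)).
  rewrite /J fZ fD hnormB_sqr -[hnorm (_ *: _) ^+ 2]rdotxx rdotZl rdotZr rdotxx.
  by rewrite hnormD_sqr; lra.
have d2 : (fun n => 2 * d n) @ \oo --> (0 : R).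
  by rewrite -(mulr0 2); apply: cvgM; [exact: cvg_cst|exact: cvg_harmonic].
have /cvg_ex[l zl] : cvgn z.
  apply: (hnorm_complete d2) => i j.
  rewrite -ler_sqr ?nnegrE ?hnorm_ge0 ?addr_ge0 ?mulr_ge0 ?ltW//.
  rewrite parallelogram.
  have := zJ i; have := zJ j; have := mJ ((2^-1)%:C *: (z i + z j)).
  by have := d0 i; have := d0 j; nra.
exists l => x; apply/eqP; rewrite eq_sym -subr_eq0; apply/eqP.
(* Passing to the limit in J (z n + t x) >= inf J for each fixed t. *)
apply: (@quadratic_ge0_eq0 (hnorm x ^+ 2)) => [|t]; first exact: sqr_ge0.
have dd : (fun n => - (d n * d n)) @ \oo --> (0 : R).
  rewrite -oppr0; apply: cvgN; rewrite -(mulr0 0).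
  by apply: cvgM; exact: cvg_harmonic.
have J_variation :
    (fun n => t ^+ 2 * hnorm x ^+ 2 + 2 * t * (rdot (z n) x - f x)) @ \oo -->
    t ^+ 2 * hnorm x ^+ 2 + 2 * t * (rdot x l - f x).
  apply: cvgD; first exact: cvg_cst.
  apply: cvgM; first exact: cvg_cst.
  by apply: cvgB; [rewrite rdotC; exact: cvg_rdot|exact: cvg_cst].
apply: ler_cvg_to dd J_variation _; apply: nearW => n.
have := mJ (z n + t%:C *: x); have := zJ n; rewrite /J fD fZ hnormD_sqr.
rewrite rdotZr -[hnorm (_ *: _) ^+ 2]rdotxx rdotZl rdotZr rdotxx; lra.
Qed.

Implicit Types S T : bounded_op H.

Lemma op_linear T : linear T.
Proof. by have /is_bounded_opP[] := op_funP T. Qed.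

Lemma opD T x y : T (x + y) = T x + T y.
Proof. by have := op_linear T 1 x y; rewrite !scale1r. Qed.

Lemma op0 T : T 0 = 0.
Proof. by apply: (addIr (T 0)); rewrite -opD !add0r. Qed.

Lemma opZ T (a : R[i]) x : T (a *: x) = a *: T x.
Proof. by have := op_linear T a x 0; rewrite op0 !addr0. Qed.

Lemma op_bounded T :
  exists2 M : R, 0 <= M & forall x, hnorm (T x) <= M * hnorm x.
Proof.
have [M M0 TM] := is_bounded_op_ge0 (op_funP T); exists M => // x.
by have := TM x; rewrite !hnormE -rmorphM lecR.
Qed.

Lemma bounded_op_of (f : H -> H) (M : R) : linear f ->
  (forall x, hnorm (f x) <= M * hnorm x) -> f \in @is_bounded_op R H.
Proof.
move=> fL fM; apply/is_bounded_opP; split=> //; exists M => x.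
by rewrite !hnormE -rmorphM lecR.
Qed.

Lemma inner_inj x y : (forall z, inner z x = inner z y) -> x = y.
Proof. by move=> xy; apply: rdot_inj => z; rewrite /rdot xy. Qed.

(** Testing the duality on x = g y gives |g y|^2 <= M |g y| |y|. *)
Lemma dual_bound (f g : H -> H) (M : R) : 0 <= M ->
    (forall x y, inner (f x) y = inner x (g y)) ->
    (forall x, hnorm (f x) <= M * hnorm x) ->
  forall y, hnorm (g y) <= M * hnorm y.
Proof.
move=> M0 fg fM y; have [->|g0] := eqVneq (hnorm (g y)) 0.
  by rewrite mulr_ge0// hnorm_ge0.
have g_gt0 : 0 < hnorm (g y) by rewrite lt0r g0 hnorm_ge0.
rewrite -(ler_pM2l g_gt0) -expr2 -rdotxx {1}/rdot -fg -/(rdot _ _).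
by rewrite (le_trans (rdot_le _ _))// mulrCA mulrA ler_wpM2r ?hnorm_ge0.
Qed.

(** Apply Riesz to x |-> Re (inner (T x) y) for each y; as T commutes with
    multiplication by 'i, equality of real parts gives the complex identity,
    and linearity of y |-> S y follows from nondegeneracy. *)
Theorem adjoint_exists T : exists S, forall x y, inner (T x) y = inner x (S y).
Proof.
have [M M0 TM] := op_bounded T.
have /choice[S TS] y : exists s, forall x, rdot (T x) y = rdot x s.
  apply: (@real_riesz _ (M * hnorm y)) => [x z|t x|x].
  - by rewrite opD rdotDl.
  - by rewrite opZ rdotZl.
  - rewrite (le_trans (rdot_le _ _))// -mulrA (mulrC (hnorm y)) mulrA.
    by rewrite ler_wpM2r// hnorm_ge0.
have TSi x y : inner (T x) y = inner x (S y).
  by rewrite !innerE -opZ !TS.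
have SL : linear S.
  move=> a y z; apply: inner_inj => x.
  by rewrite -TSi !linearDr !linearZr_LR/= !TSi.
have SM := dual_bound M0 TSi TM.
by exists (BoundedOp (bounded_op_of SL SM)).
Qed.

Lemma adjointP T x y : inner (T x) y = inner x (adjoint T y).
Proof.
by rewrite /adjoint; case: xgetP => [_ -> //|noS];
  have [S TS] := adjoint_exists T; case: (noS S).
Qed.

Lemma bounded_op_ext S T : (forall x, S x = T x) -> S = T.
Proof. by move=> ST; apply/val_inj/funext. Qed.

Lemma adjoint_unique S T :
  (forall x y, inner (T x) y = inner x (S y)) -> adjoint T = S.
Proof.
move=> TS; apply: bounded_op_ext => y; apply: inner_inj => x.
by rewrite -adjointP TS.
Qed.

Lemma adjointK T : adjoint (adjoint T) = T.
Proof. by apply: adjoint_unique => x y; rewrite innerC -adjointP -innerC. Qed.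

Lemma adjointZ (a : R[i]) T : adjoint (a *: T) = Num.conj a *: adjoint T.
Proof.
apply: adjoint_unique => x y.
rewrite [LHS]linearZl_LR/= adjointP [RHS]linearZr_LR/=; congr (_ * _).
by rewrite conjCK.
Qed.

(** Polarisation: the form (x, y) |-> inner (T x) y has a real diagonal.
    Expanding the diagonal at x + y and at 'i x + y and combining the two
    gives hermitian symmetry. *)
Lemma positive_op_selfadjoint T : positive_op T -> adjoint T = T.
Proof.
move=> T0; apply: adjoint_unique => x y.
have real_quad z : inner (T z) z = inner z (T z).
  by rewrite [RHS]innerC; apply/esym/CrealP; exact: ger0_real.
have sum_swap x' y' :
    inner (T x') y' + inner (T y') x' = inner x' (T y') + inner y' (T x').
  have := real_quad (x' + y'); rewrite opD !(linearDl, linearDr)/= !real_quad.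
  by rewrite !addrA => /addIr; rewrite -!addrA => /addrI.
have := sum_swap x y; have := sum_swap ('i *: x) y.
rewrite opZ !linearZl_LR !linearZr_LR /=.
set a := inner (T x) y; set b := inner (T y) x.
set c := inner x (T y); set d := inner y (T x).
rewrite conjCi.
move=> e1 e2; apply: (mulfI (_ : 2 * 'i != 0 :> R[i])).
  by rewrite mulf_neq0 ?pnatr_eq0 ?neq0Ci.
transitivity ('i * a + - 'i * b + 'i * (a + b)); first by ring.
by rewrite e1 e2; ring.
Qed.

End RieszAdjoint.

(** * The square root of T^* T *)

Section SquareRoot.
Context {R : realType} {H : hilbertType R}.
Implicit Types (x y : H) (a : R[i]) (S T B : bounded_op H).

Lemma op_scaleAl a S T : (a *: S) * T = a *: (S * T).
Proof. exact/val_inj. Qed.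

Lemma op_scaleAr a S T : S * (a *: T) = a *: (S * T).
Proof. by apply: bounded_op_ext => x; exact: opZ. Qed.

(** Upper bounds replace the operator norm, so that no supremum is needed. *)
Definition opnorm_le T (c : R) := forall x, hnorm (T x) <= c * hnorm x.

Lemma opnorm_leD S T c d :
  opnorm_le S c -> opnorm_le T d -> opnorm_le (S + T) (c + d).
Proof.
move=> Sc Td x; rewrite (le_trans (ler_hnormD _ _))// mulrDl.
by apply: lerD; [exact: Sc|exact: Td].
Qed.

Lemma opnorm_leM S T c d : 0 <= c ->
  opnorm_le S c -> opnorm_le T d -> opnorm_le (S * T) (c * d).
Proof.
by move=> c0 Sc Td x; rewrite (le_trans (Sc _))// -mulrA ler_wpM2l//; exact: Td.
Qed.

Lemma opnorm_leZ (t : R) T c : 0 <= t ->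
  opnorm_le T c -> opnorm_le (t%:C *: T) (t * c).
Proof.
move=> t0 Tc x; rewrite [X in hnorm X](_ : _ = t%:C *: T x)// hnormZ.
by rewrite ger0_norm ?lecR//= -mulrA ler_wpM2l//; exact: Tc.
Qed.

Section Iteration.
Context {B : bounded_op H}.
Hypotheses (B_le1 : opnorm_le B 1) (B_selfadjoint : adjoint B = B).

(** The identity (1 - Y)^2 = 1 - B amounts to Y = (B + Y^2) / 2; this is its
    fixed point iteration from 0. *)
Fixpoint sqrt_iter n : bounded_op H :=
  if n is k.+1 then (2^-1)%:C *: (B + sqrt_iter k * sqrt_iter k) else 0.

(** The same iteration for the number 1 in place of B. It increases and stays
    below 1, and controls the steps of [sqrt_iter] although the iteration need
    not be a contraction. *)
Fixpoint sqrt_majorant n : R :=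
  if n is k.+1 then 2^-1 * (1 + sqrt_majorant k * sqrt_majorant k) else 0.

Local Notation Y := sqrt_iter.
Local Notation y := sqrt_majorant.

Lemma sqrt_majorant_itv n : 0 <= y n <= 1.
Proof. by elim: n => [|n] /=; [rewrite lexx ler01|nra]. Qed.

Lemma sqrt_majorant_nondecreasing : {homo y : m n / (m <= n)%N >-> m <= n}.
Proof.
apply/nondecreasing_seqP; elim=> [|n IHn]/=; first by lra.
rewrite ler_pM2l ?invr_gt0// lerD2l.
have /andP[? _] := sqrt_majorant_itv n.
exact: ler_pM.
Qed.

Lemma sqrt_iter_comm n : Y n * B = B * Y n.
Proof.
elim: n => [|n IHn] /=; first by rewrite mul0r mulr0.
rewrite op_scaleAl op_scaleAr mulrDl mulrDr; congr (_ *: (_ + _)).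
by rewrite -mulrA IHn mulrA IHn mulrA.
Qed.

Lemma sqrt_iter_commS n : Y n * Y n.+1 = Y n.+1 * Y n.
Proof.
by rewrite /= op_scaleAl op_scaleAr mulrDl mulrDr sqrt_iter_comm mulrA.
Qed.

Lemma sqrt_iter_le n : opnorm_le (Y n) (y n).
Proof.
elim: n => [|n IHn] /=.
  by move=> x; rewrite mul0r [X in hnorm X](_ : _ = 0)// hnorm0.
apply: opnorm_leZ; first by rewrite invr_ge0.
apply: opnorm_leD => //; apply: opnorm_leM => //.
by have /andP[] := sqrt_majorant_itv n.
Qed.

(** Consecutive iterates commute, so the difference of their squares factors;
    the same factorisation holds for the scalar majorant. *)
Lemma sqrt_iter_diff n :
  Y n.+2 - Y n.+1 = (2^-1)%:C *: ((Y n.+1 + Y n) * (Y n.+1 - Y n)).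
Proof.
transitivity ((2^-1)%:C *: ((B + Y n.+1 * Y n.+1) - (B + Y n * Y n))).
  by rewrite scalerBr.
congr (_ *: _).
rewrite mulrBr !mulrDl sqrt_iter_commS.
move: (Y n.+1 * Y n.+1) (Y n * Y n) (Y n.+1 * Y n) => p q r.
by rewrite addrKA opprD addrACA subrr add0r.
Qed.

Lemma sqrt_iter_step_le n : opnorm_le (Y n.+1 - Y n) (y n.+1 - y n).
Proof.
elim: n => [|n IHn]; first by rewrite !subr0; exact: sqrt_iter_le 1%N.
rewrite sqrt_iter_diff.
have -> : y n.+2 - y n.+1 = 2^-1 * ((y n.+1 + y n) * (y n.+1 - y n)).
  transitivity (2^-1 * (1 + y n.+1 * y n.+1) - 2^-1 * (1 + y n * y n)) => //.
  by ring.
apply: opnorm_leZ; first by rewrite invr_ge0.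
apply: opnorm_leM => //; last by apply: opnorm_leD; exact: sqrt_iter_le.
have /andP[? _] := sqrt_majorant_itv n.
by have /andP[? _] := sqrt_majorant_itv n.+1; rewrite addr_ge0.
Qed.

Lemma sqrt_iter_sub_le m n : (m <= n)%N -> opnorm_le (Y n - Y m) (y n - y m).
Proof.
move=> /subnK <-; elim: (n - m)%N => [|k IHk].
  by move=> x; rewrite !subrr mul0r [X in hnorm X](_ : _ = 0) ?hnorm0.
rewrite addSn -(subrKA (Y (k + m))) -(subrKA (y (k + m))).
by apply: opnorm_leD => //; exact: sqrt_iter_step_le.
Qed.

Lemma sqrt_iter_selfadjoint n x z : inner (Y n x) z = inner x (Y n z).
Proof.
elim: n x z => [|n IHn] x z /=; first by rewrite linear0l linear0r.
rewrite [LHS]linearZl_LR [RHS]linearZr_LR/= linearDl linearDr/=.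
rewrite adjointP B_selfadjoint !IHn; congr (_ * _).
by rewrite conj_Creal// realE lecR invr_ge0 ler0n.
Qed.

Lemma sqrt_iter_cvg x : cvgn (fun n => Y n x).
Proof.
pose l := limn y.
have yl : y @ \oo --> l.
  apply: nondecreasing_is_cvgn; first exact: sqrt_majorant_nondecreasing.
  by exists 1 => _ [n _ <-]; have /andP[] := sqrt_majorant_itv n.
have y_le n : y n <= l.
  apply: nondecreasing_cvgn_le; first exact: sqrt_majorant_nondecreasing.
  by apply/cvg_ex; exists l.
apply: (@hnorm_complete _ _ _ (fun n => (l - y n) * hnorm x)).
  rewrite -(mul0r (hnorm x)); apply: cvgM; last exact: cvg_cst.
  by rewrite -(subrr l); apply: cvgB => //; exact: cvg_cst.
move=> m n; wlog mn : m n / (m <= n)%N.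
  move=> wl; have [/wl//|/ltnW/wl] := leqP m n.
  by move=> nm; rewrite hnormB [leRHS]addrC; exact: nm.
rewrite hnormB (le_trans (sqrt_iter_sub_le mn x))// -mulrDl.
by rewrite ler_wpM2r ?hnorm_ge0//; have := y_le n; lra.
Qed.

(** The iterates converge pointwise to some Y', by comparison with their scalar
    majorant. The limit satisfies the fixed point equation, so 1 - Y' squares
    to 1 - B, and it is positive because Y' is a contraction whose quadratic
    form is real. *)
Lemma sqrt_one_sub : exists S, positive_op S /\ S * S = 1 - B.
Proof.
have [L YL] : exists L : H -> H, forall x, (fun n => Y n x) @ \oo --> L x.
  by exists (fun x => limn (fun n => Y n x)) => x; exact: sqrt_iter_cvg.
have LL : linear L.
  move=> a u v.
  apply: (@norm_cvg_unique _ H _ _ _ _ (YL (a *: u + v))).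
  rewrite (_ : (fun n => _) = fun n => a *: Y n u + Y n v); last first.
    by apply/funext => n; rewrite op_linear.
  by apply: cvgD => //; apply: cvgZl_tmp.
have Y_le n : opnorm_le (Y n) 1.
  move=> x; rewrite (le_trans (sqrt_iter_le n x))// ler_wpM2r ?hnorm_ge0//.
  by have /andP[] := sqrt_majorant_itv n.
have L_le x : hnorm (L x) <= 1 * hnorm x.
  by apply: (cvg_hnorm_le (YL x)) => n; exact: Y_le.
pose Y' := BoundedOp (bounded_op_of LL L_le).
have fixpoint : Y' = (2^-1)%:C *: (B + Y' * Y').
  apply: bounded_op_ext => x.
  have YLS : (fun n => Y n.+1 x) @ \oo --> L x.
    by have := YL x; rewrite -(cvg_shiftS (fun n => Y n x)).
  apply: (@norm_cvg_unique _ H _ _ _ _ YLS).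
  apply: cvgZl_tmp; apply: cvgD; first exact: cvg_cst.
  (* Y n (Y n x) splits so that the first term is a contraction applied to a
     null sequence. *)
  rewrite (_ : (fun n => _) = fun n => Y n (Y n x - L x) + Y n (L x));
    last by apply/funext => n; rewrite -opD subrK.
  rewrite -[X in _ --> X]add0r; apply: cvgD; last exact: YL.
  apply: (@cvg_hnorm_dominated _ _ _ _ (fun n => hnorm (Y n x - L x))).
    by move=> n; rewrite subr0 (le_trans (Y_le _ _))// mul1r.
  exact: cvg_hnorm.
exists (1 - Y'); split=> [x|].
  (* Up to sign these are imaginary parts of the quadratic forms of Y' and 1. *)
  have L_real : rdot ('i *: L x) x = 0.
    have iYL : (fun n => 'i *: Y n x) @ \oo --> 'i *: L x by exact: cvgZl_tmp.
    rewrite -(cvg_lim (@Rhausdorff R) (cvg_rdot (x:=x) iYL)).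
    rewrite (_ : (fun n => _) = fun=> 0); first exact: lim_cst.
    apply/funext => n; have : inner (Y n x) x = Num.conj (inner (Y n x) x).
      by rewrite -innerC sqrt_iter_selfadjoint.
    by rewrite innerE => -[] ?; lra.
  have i_real : rdot ('i *: x) x = 0.
    by have := innerC x x; rewrite innerE => -[] ?; lra.
  rewrite innerE [X in rdot X](_ : _ = x - L x)// scalerBr !rdotDl !rdotNl.
  rewrite L_real i_real subrr oppr0 -[0]/(0%:C) lecR rdotxx.
  have := rdot_le (L x) x; have := L_le x; have := hnorm_ge0 x; nra.
rewrite mulrBr mulr1 mulrBl mul1r.
have twoY : Y' + Y' = B + Y' * Y'.
  rewrite {1 2}fixpoint -scalerDl -rmorphD/= (_ : 2^-1 + 2^-1 = 1 :> R).
    by rewrite scale1r.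
  by lra.
by rewrite -addrA -opprD addrA twoY addrK.
Qed.

End Iteration.

Lemma positive_opZ (t : R) S :
  0 <= t -> positive_op S -> positive_op (t%:C *: S).
Proof.
move=> t0 S0 x; rewrite [X in inner X](_ : _ = t%:C *: S x)// linearZl_LR/=.
by rewrite mulr_ge0// lecR.
Qed.

Lemma adjointB S T : adjoint (S - T) = adjoint S - adjoint T.
Proof.
apply: adjoint_unique => x y.
transitivity (inner (S x) y - inner (T x) y); first exact: linearBl.
by rewrite !adjointP -linearBr.
Qed.

Lemma adjointM S T : adjoint (S * T) = adjoint T * adjoint S.
Proof.
apply: adjoint_unique => x y.
by rewrite [LHS](adjointP S) [LHS]adjointP.
Qed.

Lemma adjoint1 : adjoint (1 : bounded_op H) = 1.
Proof. exact: adjoint_unique. Qed.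

Lemma opnorm_le_adjoint T c :
  0 <= c -> opnorm_le T c -> opnorm_le (adjoint T) c.
Proof. by move=> c0 Tc; exact: dual_bound (adjointP T) Tc. Qed.

(** |x - T^* T x|^2 = |x|^2 - 2 |T x|^2 + |T^* T x|^2, and the last term is at
    most |T x|^2. *)
Lemma contraction_defect T : opnorm_le T 1 -> opnorm_le (1 - adjoint T * T) 1.
Proof.
move=> T1 x; rewrite mul1r -ler_sqr ?nnegrE ?hnorm_ge0//.
rewrite [X in hnorm X](_ : _ = x - adjoint T (T x))// hnormB_sqr.
rewrite [rdot x _]/rdot -adjointP -/(rdot _ _) rdotxx.
have Tx_le : hnorm (adjoint T (T x)) <= 1 * hnorm (T x).
  exact: opnorm_le_adjoint.
have := hnorm_ge0 (adjoint T (T x)); have := hnorm_ge0 (T x); nra.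
Qed.

(** After rescaling T to a contraction T', apply [sqrt_one_sub] to
    B = 1 - T'^* T'. *)
Theorem sqrt_gram_exists T :
  exists S, positive_op S /\ S ^+ 2 = adjoint T * T.
Proof.
have [M M0 TM] := op_bounded T.
pose c : R := M + 1; have c0 : 0 < c by rewrite /c; lra.
pose T' := c^-1%:C *: T.
have T'_le1 : opnorm_le T' 1.
  rewrite -(mulVf (lt0r_neq0 c0)); apply: opnorm_leZ.
    by rewrite invr_ge0 ltW.
  move=> x; rewrite (le_trans (TM x))// ler_wpM2r ?hnorm_ge0//.
  by rewrite /c; lra.
have TE : T = c%:C *: T'.
  by rewrite /T' scalerA -rmorphM/= divff ?lt0r_neq0// scale1r.
have [||S [S0 SS]] := @sqrt_one_sub (1 - adjoint T' * T').
- exact: contraction_defect.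
- by rewrite adjointB adjointM adjointK adjoint1.
exists (c%:C *: S); split; first by apply: positive_opZ; rewrite ?ltW.
rewrite expr2 op_scaleAl op_scaleAr SS subKr [in RHS]TE adjointZ.
by rewrite op_scaleAl op_scaleAr conj_Creal// realE lecR ltW.
Qed.

Lemma abs_opP T : positive_op (abs_op T) /\ abs_op T ^+ 2 = adjoint T * T.
Proof.
rewrite /abs_op /sqrt_op; case: xgetP => [_ -> //|noS].
by have [S SP] := sqrt_gram_exists T; case: (noS S).
Qed.

Lemma abs_op_selfadjoint T : adjoint (abs_op T) = abs_op T.
Proof. by apply: positive_op_selfadjoint; have [] := abs_opP T. Qed.

End SquareRoot.

(** * Real and imaginary parts of an operator *)

Section DavisWielandt.
Context {R : realType} {H : hilbertType R}.
Implicit Types (S T : bounded_op H).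

Lemma re_opZ (a : R[i]) T :
  re_op (a *: T) = 2^-1 *: (a *: T + Num.conj a *: adjoint T).
Proof. by rewrite /re_op adjointZ. Qed.

Lemma re_op_selfadjointZ (a : R[i]) T : adjoint T = T ->
  re_op (a *: T) = (complex.Re a)%:C *: T.
Proof.
move=> TT; rewrite re_opZ TT -scalerDl scalerA; congr (_ *: _).
by rewrite addcJ mulKf// pnatr_eq0.
Qed.

Lemma im_opE T : im_op T = re_op ((- 'i) *: T).
Proof.
rewrite re_opZ /im_op.
rewrite rmorphN/= conjCi opprK scaleNr -scalerN -scalerDr (addrC (- T)).
rewrite -opprB scalerN -scaleNr scalerA invfM invCi; congr (_ *: _).
by ring.
Qed.

Lemma re_op_sqr T :
  re_op T * re_op T = (4^-1 : R[i]) *: ((T + adjoint T) * (T + adjoint T)).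
Proof.
by rewrite /re_op op_scaleAl op_scaleAr scalerA; congr (_ *: _); field.
Qed.

Lemma im_op_sqr T :
  im_op T * im_op T = (- 4^-1 : R[i]) *: ((T - adjoint T) * (T - adjoint T)).
Proof.
rewrite /im_op op_scaleAl op_scaleAr scalerA; congr (_ *: _).
rewrite -invfM mulrACA -expr2 -[X in _ * X]expr2 sqrCi mulrN1 invrN.
by congr (- _^-1); ring.
Qed.

Lemma sqrD_sub_sqrB (A : pzRingType) (a b : A) :
  (a + b) * (a + b) - (a - b) * (a - b) = (b * a + a * b) *+ 2.
Proof.
rewrite mulrDl mulrBl !mulrBr !mulrDr.
move: (a * a) (a * b) (b * a) (b * b) => p q r s.
rewrite !opprB (addrC (r - s)) addrACA (addrC p) [q + p + _]addrACA.
by rewrite [r + s + _]addrACA !subrr !addr0 mulr2n [RHS]addrACA addrC.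
Qed.

Lemma sqrD_add_sqrB (A : pzRingType) (a b : A) :
  (a + b) * (a + b) + (a - b) * (a - b) = (a * a + b * b) *+ 2.
Proof.
rewrite mulrDl mulrBl !mulrBr !mulrDr.
move: (a * a) (a * b) (b * a) (b * b) => p q r s.
rewrite opprB addrACA [p + q + _]addrACA (addrC r) [s + r + _]addrACA.
by rewrite !subrr !addr0 mulr2n [RHS]addrACA.
Qed.

Lemma double_quarter S : (2 : R[i]) *: (4^-1 *: (S *+ 2)) = S.
Proof.
rewrite -[S *+ 2](@scaler_nat R[i]) !scalerA (_ : _ * _ = 1 :> R[i]) ?scale1r//.
by field.
Qed.

Lemma sum_sqr_re_im T :
  adjoint T * T + T * adjoint T =
  (2 : R[i]) *: (re_op T * re_op T + im_op T * im_op T).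
Proof.
by rewrite re_op_sqr im_op_sqr scaleNr -scalerBr sqrD_sub_sqrB double_quarter.
Qed.

Lemma diff_sqr_re_im T :
  T ^+ 2 + adjoint T ^+ 2 =
  (2 : R[i]) *: (re_op T * re_op T - im_op T * im_op T).
Proof.
rewrite re_op_sqr im_op_sqr scaleNr opprK -scalerDr sqrD_add_sqrB.
by rewrite double_quarter !expr2.
Qed.

(** * Bounds for the Davis-Wielandt radius *)

Section Norm.
Context {N : bounded_op H -> R}.
Hypothesis hN : algebra_norm N.

Lemma anormZ_real (t : R) T : 0 <= t -> N (t%:C *: T) = t * N T.
Proof.
move=> t0; apply: complexI; rewrite anormZ// ger0_norm ?lecR//.
by rewrite -rmorphM.
Qed.

Lemma anorm0 : N 0 = 0.
Proof.
by rewrite -(scale0r (0 : bounded_op H)) (anormZ_real _ (lexx 0)) mul0r.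
Qed.

Lemma anormN T : N (- T) = N T.
Proof.
apply: complexI; rewrite -scaleN1r anormZ// normrN normr1 mul1r//.
Qed.

Lemma anorm_sqrB S T : N (S * S - T * T) <= N S ^+ 2 + N T ^+ 2.
Proof.
by rewrite (le_trans (anormD hN _ _))// anormN lerD// expr2 anormM.
Qed.

Lemma anorm_sqrD S T : N (S * S + T * T) <= N S ^+ 2 + N T ^+ 2.
Proof. by rewrite (le_trans (anormD hN _ _))// lerD// expr2 anormM. Qed.

Lemma norm_expi (theta : R) : `|expi theta| = 1 :> R[i].
Proof. by rewrite normc_def/= cos2Dsin2 sqrtr1. Qed.

Lemma anorm_re_op_expi_le (theta : R) T :
  N (re_op (expi theta *: T)) <= N T + N (adjoint T).
Proof.
rewrite re_opZ -(rmorph_nat (real_complex R)) -fmorphV anormZ_real ?invr_ge0//.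
rewrite ler_pdivrMl//.
have NZ (u : R[i]) S : `|u| = 1 -> N (u *: S) = N S.
  by move=> u1; apply: complexI; rewrite anormZ// u1 mul1r.
rewrite (le_trans (anormD hN _ _))// !NZ ?norm_conjC ?norm_expi//.
have := anorm_ge0 hN T; have := anorm_ge0 hN (adjoint T); lra.
Qed.

Definition dw_at T (theta : R) : R :=
  Num.sqrt (N (re_op (expi theta *: T)) ^+ 2
            + N (re_op (expi theta *: abs_op T)) ^+ 4).

(** A supremum in R is an upper bound only for a bounded set; here
    [anorm_re_op_expi_le] gives a bound uniform in theta. *)
Lemma dw_at_le_dw T theta : dw_at T theta <= dw N T.
Proof.
apply: sup_upper_bound; last by exists theta.
split; first by exists (dw_at T theta); exists theta.
exists (Num.sqrt ((N T + N (adjoint T)) ^+ 2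
                  + (N (abs_op T) + N (adjoint (abs_op T))) ^+ 4)).
move=> _ [t _ <-]; rewrite ler_wsqrtr// lerD//.
  by rewrite lerXn2r ?nnegrE ?addr_ge0 ?anorm_ge0 ?anorm_re_op_expi_le.
by rewrite lerXn2r ?nnegrE ?addr_ge0 ?anorm_ge0 ?anorm_re_op_expi_le.
Qed.

Lemma dw_ge0 T : 0 <= dw N T.
Proof. exact: le_trans (sqrtr_ge0 _) (dw_at_le_dw T 0). Qed.

(** The angle 0, where Re |T| = |T| as |T| is self-adjoint. *)
Lemma dw_ge_re T : N (re_op T) ^+ 2 + N (abs_op T) ^+ 4 <= dw N T ^+ 2.
Proof.
have := dw_at_le_dw T 0; rewrite /dw_at.
have -> : expi 0 = 1 :> R[i] by rewrite /expi cos0 sin0.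
have abs_re : re_op (abs_op T) = abs_op T.
  rewrite -[X in re_op X]scale1r re_op_selfadjointZ ?scale1r//.
  exact: abs_op_selfadjoint.
rewrite !scale1r abs_re -(ler_sqr (sqrtr_ge0 _) (dw_ge0 T)) sqr_sqrtr//.
by rewrite addr_ge0// exprn_ge0// anorm_ge0.
Qed.

(** The angle - pi / 2 turns Re into Im and annihilates the self-adjoint
    operator |T|. *)
Lemma dw_ge_im T : N (im_op T) ^+ 2 <= dw N T ^+ 2.
Proof.
have := dw_at_le_dw T (- (pi / 2)); rewrite /dw_at.
have -> : expi (- (pi / 2)) = - 'i :> R[i].
  rewrite /expi cosN sinN cos_pihalf sin_pihalf -complexiE.
  by apply/eqP; rewrite eq_complex /= oppr0 !eqxx.
rewrite -im_opE re_op_selfadjointZ; last exact: abs_op_selfadjoint.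
rewrite -complexiE /= oppr0 scale0r anorm0 expr0n addr0 sqrtr_sqr.
rewrite ger0_norm ?anorm_ge0// => im_le.
by rewrite ler_sqr ?nnegrE ?(anorm_ge0 hN) ?dw_ge0.
Qed.

(** By the two preceding lemmas dw^2 is at least (p + q + |p - q|) / 2, the
    maximum of p = N (Re T)^2 + N |T|^4 and q = N (Im T)^2, while the hypothesis
    says that p + q >= n / 2 + N |T|^4. *)
Lemma dw_lower_bound T (n : R) :
  n <= 2 * (N (re_op T) ^+ 2 + N (im_op T) ^+ 2) ->
  2^-1 * Num.sqrt (n + 2 * N (abs_op T) ^+ 4
    + 2 * `|N (re_op T) ^+ 2 + N (abs_op T) ^+ 4 - N (im_op T) ^+ 2|) <= dw N T.
Proof.
move=> n_le; rewrite ler_pdivrMl//.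
rewrite -[leRHS]ger0_norm ?mulr_ge0 ?dw_ge0// -[leRHS]sqrtr_sqr.
rewrite ler_wsqrtr// exprMn.
have := dw_ge_re T; have := dw_ge_im T.
by case: ler0P; nra.
Qed.

End Norm.
End DavisWielandt.

Theorem theorem3 (R : realType) (H : hilbertType R) (T : bounded_op H)
    (N : bounded_op H -> R) (hN : algebra_norm N) :
  dw N T >= 2^-1 * Num.sqrt
    (N (abs_op T ^+ 2 + abs_op (adjoint T) ^+ 2) + 2 * N (abs_op T) ^+ 4
     + 2 * `|N (re_op T) ^+ 2 + N (abs_op T) ^+ 4 - N (im_op T) ^+ 2|)
  /\
  dw N T >= 2^-1 * Num.sqrt
    (N (T ^+ 2 + adjoint T ^+ 2) + 2 * N (abs_op T) ^+ 4
     + 2 * `|N (re_op T) ^+ 2 + N (abs_op T) ^+ 4 - N (im_op T) ^+ 2|).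
Proof.
have N2 S : N ((2 : R[i]) *: S) = 2 * N S.
  by rewrite -(anormZ_real hN)// rmorph_nat.
split; apply: dw_lower_bound => //.
  rewrite !(abs_opP _).2 adjointK sum_sqr_re_im N2 ler_pM2l//.
  exact: anorm_sqrD.
by rewrite diff_sqr_re_im N2 ler_pM2l// anorm_sqrB.
Qed.
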